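(* Suppose $\mathcal{A}\in\mathbb{C}^{\mathbf{I}(N)\times\mathbf{I}(N)}$ has the full-rank factorization $\mathcal{A}=\mathcal{F}*_L\mathcal{G}$, where $\mathcal{F}\in\mathbb{C}^{\mathbf{I}(N)\times K_1\times\cdots\times K_L}$ and $\mathcal{G}\in\mathbb{C}^{K_1\times\cdots\times K_L\times\mathbf{I}(N)}$. Then $\mathcal{A}$ is group invertible if and only if $\mathcal{G}*_N\mathcal{F}$ is nonsingular. Further, in that case, $$\mathcal{A}^{\#}=\mathcal{F}*_L(\mathcal{G}*_N\mathcal{F})^{-2}*_L\mathcal{G}.$$
   Context: For positive integers $I_1,\dots,I_N$ write $\mathbf{I}(N)=I_1\times\cdots\times I_N$; $\mathbb{C}^{\mathbf{I}(M)\times\mathbf{J}(N)}$ is the set of complex tensors with entries $a_{i_1\dots i_M j_1\dots j_N}$, $1\le i_s\le I_s$, $1\le j_s\le J_s$. The Einstein product of $\mathcal{A}\in\mathbb{C}^{\mathbf{I}(M)\times\mathbf{K}(L)}$ and $\mathcal{B}\in\mathbb{C}^{\mathbf{K}(L)\times\mathbf{J}(N)}$ is $(\mathcal{A}*_L\mathcal{B})_{i_1\dots i_M j_1\dots j_N}=\sum_{k_1,\dots,k_L}a_{i_1\dots i_M k_1\dots k_L}b_{k_1\dots k_L j_1\dots j_N}$. A tensor in $\mathbb{C}^{\mathbf{K}(L)\times\mathbf{K}(L)}$ is nonsingular if it is invertible under $*_L$; the exponent $-2$ means the square of the inverse. The reshaping rank $rshrank(\mathcal{A})$ of $\mathcal{A}\in\mathbb{C}^{\mathbf{I}(M)\times\mathbf{J}(N)}$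 is the rank of the $(I_1\cdots I_M)\times(J_1\cdots J_N)$ matrix obtained by reshaping $\mathcal{A}$ (merging the first $M$ indices into a row index and the last $N$ into a column index). A full-rank factorization $\mathcal{A}=\mathcal{F}*_L\mathcal{G}$ is one in which $\mathcal{F}$ is left invertible, $\mathcal{G}$ is right invertible, and $rshrank(\mathcal{F})=rshrank(\mathcal{G})=rshrank(\mathcal{A})=K_1K_2\cdots K_L$. A tensor $\mathcal{A}\in\mathbb{C}^{\mathbf{I}(N)\times\mathbf{I}(N)}$ is group invertible if there is a (necessarily unique) $\mathcal{X}\in\mathbb{C}^{\mathbf{I}(N)\times\mathbf{I}(N)}$ with $\mathcal{A}*_N\mathcal{X}*_N\mathcal{A}=\mathcal{A}$, $\mathcal{X}*_N\mathcal{A}*_N\mathcal{X}=\mathcal{X}$, $\mathcal{A}*_N\mathcal{X}=\mathcal{X}*_N\mathcal{A}$; then $\mathcal{A}^{\#}=\mathcal{X}$ is the group inverse. *)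

(* Defs.v *)
From mathcomp Require Import all_boot all_order all_algebra.
From mathcomp Require Import boolp classical_sets reals complex.

Set Implicit Arguments.
Unset Strict Implicit.
Unset Printing Implicit Defensive.

Import GRing.Theory Num.Theory.
Local Open Scope ring_scope.
Local Open Scope complex_scope.

(* Tensors are polymorphic in R : realType, so R[i] is the field of complex   *)
(* numbers.  A multi-index (i_1, ..., i_N) with 1 <= i_s <= I_s is encoded    *)
(* 0-based, as a dependent finite function s |-> i_s in 'I_(I s).             *)
Definition midx (N : nat) (I : 'I_N -> nat) : finType :=
  {dffun forall s : 'I_N, 'I_(I s)}.

Lemma card_midx (N : nat) (I : 'I_N -> nat) :
  #|midx I| = (\prod_(s < N) I s)%N.
Proof.
by rewrite card_dep_ffun foldrE big_map big_enum; apply: eq_bigr => s _;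
  rewrite card_ord.
Qed.

Definition tensor (R : realType) (M N : nat) (I : 'I_M -> nat)
  (J : 'I_N -> nat) := {ffun midx I * midx J -> R[i]}.

Section Einstein.
Variable R : realType.

(* The number L of contracted indices is read off the type of K. *)
Definition einstein (M L N : nat) (I : 'I_M -> nat) (K : 'I_L -> nat)
    (J : 'I_N -> nat) (A : tensor R I K) (B : tensor R K J) : tensor R I J :=
  [ffun p => \sum_(k : midx K) A (p.1, k) * B (k, p.2)].

Definition tid (L : nat) (K : 'I_L -> nat) : tensor R K K :=
  [ffun p => (p.1 == p.2)%:R].

Local Notation "A *t B" := (einstein A B) (at level 40, left associativity).

Definition left_invertible (M N : nat) (I : 'I_M -> nat) (J : 'I_N -> nat)
    (A : tensor R I J) : Prop :=
  exists X : tensor R J I, X *t A = tid J.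

Definition right_invertible (M N : nat) (I : 'I_M -> nat) (J : 'I_N -> nat)
    (A : tensor R I J) : Prop :=
  exists X : tensor R J I, A *t X = tid I.

Definition is_tinv (L : nat) (K : 'I_L -> nat) (A X : tensor R K K) : Prop :=
  A *t X = tid K /\ X *t A = tid K.

Definition nonsingular (L : nat) (K : 'I_L -> nat) (A : tensor R K K) : Prop :=
  exists X : tensor R K K, is_tinv A X.

(* The inverse of A, with junk value 0 when A is singular. *)
Definition tinv (L : nat) (K : 'I_L -> nat) (A : tensor R K K) : tensor R K K :=
  xget 0 [set X | is_tinv A X]%classic.

Definition is_ginv (N : nat) (I : 'I_N -> nat) (A X : tensor R I I) : Prop :=
  [/\ A *t X *t A = A, X *t A *t X = X & A *t X = X *t A].

Definition group_invertible (N : nat) (I : 'I_N -> nat) (A : tensor R I I) :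
    Prop :=
  exists X : tensor R I I, is_ginv A X.

(* The group inverse of A, with junk value 0 when A is not group invertible. *)
Definition ginv (N : nat) (I : 'I_N -> nat) (A : tensor R I I) : tensor R I I :=
  xget 0 [set X | is_ginv A X]%classic.

(* Multi-indices are merged along the library's enumeration of midx; by       *)
(* card_midx this is an (I_1 ... I_M) x (J_1 ... J_N) matrix.  Another        *)
(* merging order would only permute its rows and columns.                     *)
Definition reshape_tensor (M N : nat) (I : 'I_M -> nat) (J : 'I_N -> nat)
    (A : tensor R I J) : 'M[R[i]]_(#|midx I|, #|midx J|) :=
  \matrix_(i, j) A (enum_val i, enum_val j).

Definition rshrank (M N : nat) (I : 'I_M -> nat) (J : 'I_N -> nat)
    (A : tensor R I J) : nat :=
  \rank (reshape_tensor A).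

Definition full_rank_factorization (M L N : nat) (I : 'I_M -> nat)
    (K : 'I_L -> nat) (J : 'I_N -> nat)
    (A : tensor R I J) (F : tensor R I K) (G : tensor R K J) : Prop :=
  [/\ A = F *t G, left_invertible F, right_invertible G
    & [/\ rshrank F = rshrank A, rshrank G = rshrank A
        & rshrank A = (\prod_(s < L) K s)%N]].

End Einstein.

Notation "A *t B" := (einstein A B) (at level 40, left associativity).

(* Main.v *)
(* With X := A^#, the identities A = X A A = A A X and the one-sided inverses
   F' of F and G' of G give F = X F (G F) and G = (G F) G X, so that G F has
   the left inverse F' X F and the right inverse G X G'.  Conversely, if Y
   inverts G F, then X := F Y Y G satisfies A X = F Y G = X A, from which the
   defining equations of the group inverse follow. *)
Require Import Defs.
From mathcomp Require Import all_boot all_order all_algebra.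
From mathcomp Require Import classical_sets reals complex.

Set Implicit Arguments.
Unset Strict Implicit.
Unset Printing Implicit Defensive.

Import GRing.Theory.

Lemma einsteinA (R : realType) (M L P N : nat) (I : 'I_M -> nat)
    (K : 'I_L -> nat) (H : 'I_P -> nat) (J : 'I_N -> nat)
    (A : tensor R I K) (B : tensor R K H) (C : tensor R H J) :
  A *t (B *t C) = A *t B *t C.
Proof.
apply/ffunP => p; rewrite !ffunE.
under eq_bigr => k _ do rewrite ffunE big_distrr.
rewrite exchange_big; apply: eq_bigr => h _ /=.
by rewrite ffunE big_distrl; apply: eq_bigr => k _; rewrite mulrA.
Qed.

Lemma einstein1t (R : realType) (M N : nat) (I : 'I_M -> nat) (J : 'I_N -> nat)
    (A : tensor R I J) : tid R I *t A = A.
Proof.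
apply/ffunP => -[i j]; rewrite ffunE (bigD1 i) //= ffunE eqxx mul1r.
by rewrite big1 ?addr0 // => k /negPf ki; rewrite ffunE eq_sym ki mul0r.
Qed.

Lemma einsteint1 (R : realType) (M N : nat) (I : 'I_M -> nat) (J : 'I_N -> nat)
    (A : tensor R I J) : A *t tid R J = A.
Proof.
apply/ffunP => -[i j]; rewrite ffunE (bigD1 j) //= ffunE eqxx mulr1.
by rewrite big1 ?addr0 // => k /negPf kj; rewrite ffunE kj mulr0.
Qed.

Lemma nonsingular_tinv (R : realType) (L : nat) (K : 'I_L -> nat)
    (A : tensor R K K) : nonsingular A -> is_tinv A (tinv A).
Proof. exact: xgetPex. Qed.

(** Associativity makes the two one-sided inverses coincide: [Y = (X A) Y = X (A Y) = X]. *)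
Lemma nonsingular_left_right (R : realType) (L : nat) (K : 'I_L -> nat)
    (A : tensor R K K) :
  left_invertible A -> right_invertible A -> nonsingular A.
Proof.
move=> [X XA] [Y AY]; exists Y; split=> //.
by rewrite -[Y]einstein1t -XA -(einsteinA X) AY einsteint1.
Qed.

Lemma is_ginv_unique (R : realType) (N : nat) (I : 'I_N -> nat)
    (A X Y : tensor R I I) : is_ginv A X -> is_ginv A Y -> X = Y.
Proof.
move=> [AXA XAX AX] [AYA YAY AY].
(* [A X = A Y A X = Y A A X = Y A X A = Y A = A Y]. *)
have AXY : A *t X = A *t Y.
  rewrite -{1}AYA AY -!einsteinA AX !einsteinA.
  by rewrite -(einsteinA Y) -(einsteinA Y) AXA.
(* [X = X A X = X A Y = A X Y = A Y Y = Y A Y = Y]. *)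
by rewrite -XAX -einsteinA AXY einsteinA -AX AXY AY.
Qed.

(** Once some group inverse exists, [xget] returns a genuine one, and uniqueness identifies it with
    [X]. *)
Lemma ginvE (R : realType) (N : nat) (I : 'I_N -> nat) (A X : tensor R I I) :
  is_ginv A X -> ginv A = X.
Proof.
by move=> AX; apply: (is_ginv_unique _ AX); apply: xgetPex; exists X.
Qed.

Lemma is_ginv_mul (R : realType) (N L : nat) (I : 'I_N -> nat)
    (K : 'I_L -> nat) (F : tensor R I K) (G : tensor R K I)
    (Y : tensor R K K) :
  is_tinv (G *t F) Y -> is_ginv (F *t G) (F *t (Y *t Y) *t G).
Proof.
move=> [GFY YGF].
have AX : F *t G *t (F *t (Y *t Y) *t G) = F *t Y *t G.
  by rewrite !einsteinA -(einsteinA F G) -(einsteinA F) GFY einsteint1.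
have XA : F *t (Y *t Y) *t G *t (F *t G) = F *t Y *t G.
  rewrite !einsteinA -(einsteinA _ G F).
  by rewrite -(einsteinA _ Y (G *t F)) YGF einsteint1.
(* Both [A X] and [X A] are now [F Y G]; multiplying it by [A] or [X], which begin with [F], creates
   a factor [Y (G F)] that cancels. *)
split; last by rewrite AX XA.
- rewrite AX !einsteinA -(einsteinA _ G F).
  by rewrite -(einsteinA _ Y (G *t F)) YGF einsteint1.
- rewrite XA !einsteinA -(einsteinA _ G F).
  by rewrite -(einsteinA _ Y (G *t F)) YGF einsteint1.
Qed.

Lemma group_invertible_nonsingular (R : realType) (N L : nat)
    (I : 'I_N -> nat) (K : 'I_L -> nat) (F : tensor R I K) (G : tensor R K I) :
  left_invertible F -> right_invertible G -> group_invertible (F *t G) ->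
  nonsingular (G *t F).
Proof.
move=> [F' F'F] [G' GG'] [X [AXA _ AX]].
apply: nonsingular_left_right.
- exists (F' *t X *t F).
  (* Commutation turns [A X A = A] into [X A A = A]; between [F'] and [G'], the factors [F' F] and
     [G G'] cancel, leaving [(F' X F) (G F) = 1]. *)
  have /(congr1 (fun T => F' *t T *t G')) := AXA.
  by rewrite AX !einsteinA F'F einstein1t -!(einsteinA _ G G') GG' !einsteint1.
- exists (G *t X *t G').
  (* Symmetrically, [A A X = A] leaves [(G F) (G X G') = 1]. *)
  have /(congr1 (fun T => F' *t T *t G')) := AXA.
  by rewrite -(einsteinA _ X) -AX !einsteinA F'F !einstein1t GG'.
Qed.

Theorem theorem3p24 (R : realType) (N L : nat) (hN : (0 < N)%N) (hL : (0 < L)%N)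
    (I : 'I_N -> nat) (hI : forall s : 'I_N, (0 < I s)%N)
    (K : 'I_L -> nat) (hK : forall s : 'I_L, (0 < K s)%N)
    (A : tensor R I I) (F : tensor R I K) (G : tensor R K I)
    (hA : full_rank_factorization A F G) :
  (group_invertible A <-> nonsingular (G *t F)) /\
  (group_invertible A ->
     ginv A = F *t (tinv (G *t F) *t tinv (G *t F)) *t G).
Proof.
case: hA => -> Fl Gr _.
have GF := group_invertible_nonsingular Fl Gr.
(* Group invertibility makes [G F] nonsingular, so [tinv] is a true inverse here and not the default
   0. *)
split=> [|/GF/nonsingular_tinv/is_ginv_mul/ginvE //].
split=> [//|/nonsingular_tinv/is_ginv_mul AX].
by exists (F *t (tinv (G *t F) *t tinv (G *t F)) *t G).
Qed.
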